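(* Let $Y$ be a real vector space, $F\subseteq Y$, $D$ a nonempty proper subset of $Y$ and $k\in Y\setminus\{0\}$. Assume $k\in0^+D$ and that $D$ is $(-k)$-directionally closed. Then $$\operatorname{Eff}(F,D)=\{y^0\in F\mid\forall y\in(F\cap\operatorname{dom}\varphi_{y^0-D,k})\setminus\{y^0\}:\ \varphi_{y^0-D,k}(y)>0\}$$ $$=\{y^0\in F\mid\forall y\in(F\cap\operatorname{dom}\varphi_{y^0-D,k})\setminus\{y^0\}:\ \varphi_{-D,k}(y-y^0)>0\}.$$ If $0\in D$, then $\varphi_{y^0-D,k}(y^0)=\varphi_{-D,k}(y^0-y^0)\le0$ for each $y^0\in Y$. If $D+\mathbb{R}_>k\subseteq\operatorname{core}D$ and $0\in D\setminus\operatorname{core}D$, then $\varphi_{y^0-D,k}(y^0)=\varphi_{-D,k}(y^0-y^0)=0$ for each $y^0\in Y$ and $$\operatorname{Eff}(F,D)=\{y^0\in F\mid\forall y\in(F\cap\operatorname{dom}\varphi_{y^0-D,k})\setminus\{y^0\}:\ \varphi_{y^0-D,k}(y^0)<\varphi_{y^0-D,k}(y)\},$$ $$\operatorname{Eff}(F,D)=\{y^0\in F\mid\forall y\in(F\cap\operatorname{dom}\varphi_{y^0-D,k})\setminus\{y^0\}:\ \varphi_{-D,k}(y^0-y^0)<\varphi_{-D,k}(y-y^0)\}.$$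
   Context: For $F,D\subseteq Y$, $\operatorname{Eff}(F,D):=\{y^0\in F\mid F\cap(y^0-D)\subseteq\{y^0\}\}$. Let $\nu$ be a symbol not in $\mathbb{R}\cup\{-\infty,+\infty\}$ and $\inf\emptyset:=\nu$. For nonempty $A\subseteq Y$ and $k\in Y\setminus\{0\}$, $\varphi_{A,k}(y):=\inf\{t\in\mathbb{R}\mid y\in A+tk\}$ ($-\infty$ if unbounded below) and $\operatorname{dom}\varphi_{A,k}=\{y\in Y\mid\varphi_{A,k}(y)\in\mathbb{R}\cup\{-\infty\}\}$. $\mathbb{R}_>=(0,\infty)$. $0^+D:=\{u\in Y\mid\forall d\in D\ \forall t\in[0,\infty):\ d+tu\in D\}$. $\operatorname{core}D$ is the algebraic interior: $d\in\operatorname{core}D$ iff $d\in D$ and for each $v\in Y$ there is $\varepsilon>0$ with $d+sv\in D$ for all $s\in[0,\varepsilon]$. $D$ is $(-k)$-directionally closed if for every $y\in Y$: whenever there is a sequence $(t_n)$ of positive reals decreasing to $0$ with $y+t_nk\in D$ for all $n$, then $y\in D$. *)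

(* Defs.v *)
From mathcomp Require Import all_boot all_order all_algebra.
From mathcomp Require Import all_classical all_reals ereal topology normedtype sequences.
Set Implicit Arguments.
Unset Strict Implicit.
Unset Printing Implicit Defensive.
Import Order.TTheory GRing.Theory Num.Theory.
Import numFieldNormedType.Exports.
Local Open Scope classical_set_scope.
Local Open Scope ring_scope.

(* The extended reals together with the extra symbol nu: [None] is nu, and
   [Some x] is the extended real [x]. The symbol nu is comparable to nothing. *)
Definition ereal_nu (R : realType) := option (\bar R).

Definition nu {R : realType} : ereal_nu R := None.

Definition le_nu (R : realType) (x y : ereal_nu R) : Prop :=
  match x, y with
  | Some a, Some b => (a <= b)%E
  | _, _ => False
  end.

Definition lt_nu (R : realType) (x y : ereal_nu R) : Prop :=
  match x, y with
  | Some a, Some b => (a < b)%E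
  | _, _ => False
  end.

(* Infimum of a set of reals with the convention inf set0 = nu (rather than
   the value +oo of [ereal_inf set0]). *)
Definition inf_nu (R : realType) (S : set R) : ereal_nu R :=
  if `[< S !=set0 >] then Some (ereal_inf (EFin @` S)) else nu.

Section VectorSpace.
Context {R : realType} {Y : lmodType R}.
Implicit Types (A D F : set Y) (k y : Y).

Definition opp_set D : set Y := [set - d | d in D].

Definition point_sub_set y D : set Y := [set y - d | d in D].

Definition Eff F D : set Y :=
  [set y0 | F y0 /\ F `&` point_sub_set y0 D `<=` [set y0]].

Definition phi A k y : ereal_nu R :=
  inf_nu [set t : R | [set a + t *: k | a in A] y].

Definition dom_phi A k : set Y :=
  [set y | phi A k y = Some -oo%E \/ exists r : R, phi A k y = Some r%:E].

Definition recession D : set Y :=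
  [set u | forall d, D d -> forall t : R, 0 <= t -> D (d + t *: u)].

Definition alg_core D : set Y :=
  [set d | D d /\ forall v, exists2 eps : R, 0 < eps &
     forall s : R, 0 <= s <= eps -> D (d + s *: v)].

Definition add_pos_ray D k : set Y :=
  [set d + t *: k | d in D & t in [set t : R | 0 < t]].

(* Closedness of [D] in direction [-k]: the argument is [k] itself. The sequence
   is taken strictly decreasing, which is equivalent to nonincreasing here. *)
Definition opp_dir_closed D k : Prop :=
  forall y, (exists t : nat -> R,
      [/\ forall n, 0 < t n, decreasing_seq t, t n @[n --> \oo] --> (0 : R) &
          forall n, D (y + t n *: k)]) ->
    D y.

End VectorSpace.

(* Main.v *)
Require Import Defs.
From mathcomp Require Import all_boot all_order all_algebra.
From mathcomp Require Import all_classical all_reals ereal topology normedtype sequences.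
Import Order.TTheory GRing.Theory Num.Theory.
Local Open Scope classical_set_scope.
Local Open Scope ring_scope.

(** The idea is that every functional in sight is one and the same scalar
    problem on a line: both [phi (point_sub_set y0 D) k y] and
    [phi (opp_set D) k (y - y0)] are the infimum of the parameters [t] for which
    [y0 - y + t *: k] lies in [D] (lemmas [phi_point_subE] and [phi_oppE]).

    Since [k] is a recession direction, that set of parameters is an upper ray of
    the real line, and directional closedness says that the ray contains its
    finite endpoint. So the infimum being nonpositive means exactly that [0] is
    in the ray, i.e. that [y] belongs to [y0 - D] (lemma [inf_line_params_le0]).
    Efficiency of [y0] forbids this for [y != y0] in [F]; as the functional is
    nonpositive only on its domain, it amounts to the functional being positive
    on that domain, away from [y0] ([EffE]).

    When [0] is in [D], the value at [y = y0] is thus nonpositive. If it were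
    negative, [t *: k] would be in [D] for some [t < 0], and then
    [0 = t *: k + (- t) *: k] would be in [D + R_> k], hence in the algebraic
    core. So the value is [0] once [0] is outside the core, and positivity is the
    same as being greater than the value at [y0]. *)

Section LineParameters.
Set Implicit Arguments.
Unset Strict Implicit.
Unset Printing Implicit Defensive.
Context {R : realType} {Y : lmodType R}.
Implicit Types (D F : set Y) (k y z : Y).

Definition line_params D k z : set R := [set t | D (z + t *: k)].

Lemma phi_point_subE D k y0 y :
  phi (point_sub_set y0 D) k y = inf_nu (line_params D k (y0 - y)).
Proof.
congr inf_nu; apply/seteqP; split => t /=.
  case=> _ [d Dd <-] <-; rewrite /line_params /=.
  by rewrite opprD opprB addrA subrK subrKC.
move=> Dt; exists (y0 - (y0 - y + t *: k)); first by exists (y0 - y + t *: k).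
by rewrite opprD opprB addrA subrK subrKC.
Qed.

(** [opp_set D] is the reflection of [D] at the origin, so this is the previous
    lemma after a translation by [y0]. *)
Lemma phi_oppE D k y0 y :
  phi (opp_set D) k (y - y0) = inf_nu (line_params D k (y0 - y)).
Proof.
have -> : opp_set D = point_sub_set 0 D.
  by apply/seteqP; split => x [d Dd <-]; exists d => //; rewrite sub0r.
by rewrite phi_point_subE sub0r opprB.
Qed.

Lemma line_params_up D k z (s t : R) :
  recession D k -> s <= t -> line_params D k z s -> line_params D k z t.
Proof.
move=> k_rec le_st /k_rec/(_ (t - s)); rewrite subr_ge0 => /(_ le_st).
by rewrite -addrA -scalerDl subrKC.
Qed.

(** Membership of the whole open ray provides in particular its points with
    harmonic parameters, which are a sequence as directional closedness asks. *)
Lemma opp_dir_closed_pos D k z : opp_dir_closed D k ->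
  (forall t : R, 0 < t -> line_params D k z t) -> D z.
Proof.
move=> D_closed Dpos; apply: D_closed; exists harmonic; split.
- by move=> n; rewrite /harmonic /= invr_gt0.
- by move=> m n; rewrite /harmonic /= lef_pV2 ?posrE// ler_nat ltnS.
- exact: cvg_harmonic.
- by move=> n; apply: Dpos; rewrite /harmonic /= invr_gt0.
Qed.

Lemma inf_nu_le_mem (S : set R) (t : R) :
  S t -> le_nu (inf_nu S) (Some t%:E).
Proof.
move=> St; rewrite /inf_nu asboolT; last by exists t.
by apply: ereal_inf_lbound; exists t.
Qed.

Lemma inf_nu_lt (S : set R) (t : R) :
  lt_nu (inf_nu S) (Some t%:E) -> exists2 s, S s & s < t.
Proof.
rewrite /inf_nu; case: asboolP => //= _ /ereal_inf_lt[_ [s Ss <-]].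
by rewrite lte_fin; exists s.
Qed.

(** The scalar core of the argument: if the infimum is at most [0], every
    [t > 0] exceeds some parameter, hence is one itself by the recession
    property; closedness then reaches [0]. *)
Lemma inf_line_params_le0 D k z : recession D k -> opp_dir_closed D k ->
  le_nu (inf_nu (line_params D k z)) (Some 0%E) <-> D z.
Proof.
move=> k_rec D_closed; split => [inf_le0|Dz]; last first.
  by apply: inf_nu_le_mem; rewrite /line_params /= scale0r addr0.
apply: (opp_dir_closed_pos D_closed) => t t_gt0.
have [|s Ds /ltW le_st] := @inf_nu_lt (line_params D k z) t.
  by case: inf_nu inf_le0 => //= x x_le0; apply: le_lt_trans x_le0 _.
exact: line_params_up le_st Ds.
Qed.

(** A value at most [0] puts [y] in the domain, and on the domain the value is
    comparable with [0]; outside it, the value is nu or [+oo]. So positivity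
    required on the domain only is still the exact negation of being at most
    [0], although nu itself is comparable with nothing. *)
Lemma dom_phi_gt0 A k y (P : Prop) :
  (le_nu (phi A k y) (Some 0%E) <-> P) ->
  (dom_phi A k y -> lt_nu (Some 0%E) (phi A k y)) <-> ~ P.
Proof.
rewrite /dom_phi /=; case: phi => [x|] /= <-; last first.
  by split=> [_ H|_ [H|[r H]]].
split=> [dom_gt0 x_le0|/negP]; last by rewrite -ltNge.
suff /dom_gt0 : Some x = Some -oo%E \/ exists r : R, Some x = Some r%:E.
  by rewrite ltNge x_le0.
by case: x x_le0 {dom_gt0} => [r| |]// _; [right; exists r|left].
Qed.

(** Being efficient means that no [y != y0] of [F] has [y0 - y] in [D], which
    the sublevel description of the functional turns into positivity. *)
Lemma EffE F D k : recession D k -> opp_dir_closed D k ->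
  Eff F D =
    [set y0 | F y0 /\
       forall y, ((F `&` dom_phi (point_sub_set y0 D) k) `\ y0) y ->
         lt_nu (Some 0%E) (phi (point_sub_set y0 D) k y)].
Proof.
move=> k_rec D_closed.
have gt0E y0 y :
    (dom_phi (point_sub_set y0 D) k y ->
      lt_nu (Some 0%E) (phi (point_sub_set y0 D) k y)) <-> ~ D (y0 - y).
  by apply: dom_phi_gt0; rewrite phi_point_subE; apply: inf_line_params_le0.
apply/seteqP; split => y0 [Fy0 y0P]; split => // y.
  move=> [[Fy domy] y_neq]; apply: (gt0E y0 y).2 domy => Dy; apply: y_neq.
  by apply: y0P; split => //; exists (y0 - y) => //; rewrite opprB subrKC.
move=> [Fy [d Dd yE]]; apply: contrapT => y_neq.
apply: (gt0E y0 y).1 => [domy|]; first by apply: y0P.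
by rewrite -yE opprB subrKC.
Qed.

(** A negative parameter would place [0] itself in [add_pos_ray D k], hence in
    the core. *)
Lemma inf_line_params0 D k :
  add_pos_ray D k `<=` alg_core D -> (D `\` alg_core D) 0 ->
  inf_nu (line_params D k 0) = Some 0%E.
Proof.
move=> ray_core [D0 core0].
have inf_le0 : le_nu (inf_nu (line_params D k 0)) (Some 0%E).
  by apply: inf_nu_le_mem; rewrite /line_params /= scale0r addr0.
have inf_nlt0 : ~ lt_nu (inf_nu (line_params D k 0)) (Some 0%E).
  move=> /inf_nu_lt[t]; rewrite /line_params /= add0r => Dt t_lt0.
  apply/core0/ray_core; exists (t *: k) => //.
  by exists (- t); rewrite /= ?oppr_gt0// scaleNr subrr.
case: inf_nu inf_le0 inf_nlt0 => //= x x_le0 /negP.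
by rewrite -leNgt => x_ge0; congr Some; apply/le_anti/andP.
Qed.

End LineParameters.

Theorem theorem7 (R : realType) (Y : lmodType R) (F D : set Y) (k : Y)
    (D_nonempty : D !=set0) (D_proper : D `<` [set: Y]) (k_neq0 : k != 0)
    (k_rec : recession D k) (D_closed : opp_dir_closed D k) :
  [/\ Eff F D =
        [set y0 | F y0 /\
           forall y, ((F `&` dom_phi (point_sub_set y0 D) k) `\ y0) y ->
             lt_nu (Some 0%E) (phi (point_sub_set y0 D) k y)],
      [set y0 | F y0 /\
         forall y, ((F `&` dom_phi (point_sub_set y0 D) k) `\ y0) y ->
           lt_nu (Some 0%E) (phi (point_sub_set y0 D) k y)] =
        [set y0 | F y0 /\
           forall y, ((F `&` dom_phi (point_sub_set y0 D) k) `\ y0) y ->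
             lt_nu (Some 0%E) (phi (opp_set D) k (y - y0))],
      D 0 ->
        forall y0 : Y,
          phi (point_sub_set y0 D) k y0 = phi (opp_set D) k (y0 - y0) /\
          le_nu (phi (opp_set D) k (y0 - y0)) (Some 0%E)
    & add_pos_ray D k `<=` alg_core D ->
      (D `\` alg_core D) 0 ->
        [/\ forall y0 : Y,
              phi (point_sub_set y0 D) k y0 = phi (opp_set D) k (y0 - y0) /\
              phi (opp_set D) k (y0 - y0) = Some 0%E,
            Eff F D =
              [set y0 | F y0 /\
                 forall y, ((F `&` dom_phi (point_sub_set y0 D) k) `\ y0) y ->
                   lt_nu (phi (point_sub_set y0 D) k y0)
                         (phi (point_sub_set y0 D) k y)]
          & Eff F D =
              [set y0 | F y0 /\
                 forall y, ((F `&` dom_phi (point_sub_set y0 D) k) `\ y0) y ->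
                   lt_nu (phi (opp_set D) k (y0 - y0))
                         (phi (opp_set D) k (y - y0))]]].
Proof.
have phiE y0 y : phi (point_sub_set y0 D) k y = phi (opp_set D) k (y - y0).
  by rewrite phi_point_subE phi_oppE.
have EffD := EffE F k_rec D_closed.
split=> //.
- by apply/seteqP; split => y0 [Fy0 gt0]; split => // y /gt0; rewrite phiE.
- move=> D0 y0; split; first exact: phiE.
  by rewrite phi_oppE subrr; apply/inf_line_params_le0.
move=> ray_core D0.
have phi0 y0 : phi (opp_set D) k (y0 - y0) = Some 0%E.
  by rewrite phi_oppE subrr inf_line_params0.
split=> //; rewrite EffD; apply/seteqP.
- by split => y0 [Fy0 gt0]; split => // y /gt0; rewrite (phiE y0 y0) phi0.
- by split => y0 [Fy0 gt0]; split => // y /gt0; rewrite phi0 phiE.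
Qed.
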